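(* Let $\pi=(\pi_A,\pi_B)$ be a probability distribution on the state space $S$ and let $\gamma(\pi)=\pi_B+\pi_A(I-\Omega_{AA})^{-1}\Omega_{AB}$, which is a probability distribution on $B$. Then for any $0<h<T$, $$\lim_{\lambda\to\infty}\ \sup_{h\le t\le T} d_{TV}\bigl(P^\lambda_\pi(X_t\in\cdot),\,P_{\gamma(\pi)}(Y_t\in\cdot)\bigr)=0 .$$
   Context: Setting. $S=\{1,\dots,|S|\}$ is a finite set. For each $\lambda>0$, $Q(\lambda)=(q_{ij}(\lambda))$ is an irreducible transition rate matrix on $S$ (nonnegative off-diagonal entries, rows summing to $0$), and $X=\{X_t:t\ge0\}$ is the continuous-time Markov chain on $S$ with transition rate matrix $Q(\lambda)$; $P^\lambda_\pi$ denotes its law with initial distribution $\pi$, and $P^\lambda_i$ its law started from state $i$. For all $i\ne j$, $\lim_{\lambda\to\infty}q_{ij}(\lambda)$ exists in $[0,\infty]$. Put $q_i(\lambda)=-q_{ii}(\lambda)=\sum_{j\ne i}q_{ij}(\lambda)$ and $q_i=\lim_{\lambda\to\infty}q_i(\lambda)\in[0,\infty]$. The fast state space is $A=\{i:q_i=\infty\}$ and the slow state space is $B=\{i:q_i<\infty\}$; it is assumed that $B\neq\emptyset$ and $q_i>0$ for all $i\in B$. States are labelled so that those of $A$ come first, and matrices on $S$ are written in blocks with indices $A,B$ (row vectors likewise, so $\pi=(\pi_A,\pi_B)$ is a row vector). $Q=\lim_{\lambda\to\infty}Q(\lambda)$ entrywise; the blocks $Q_{BA},Q_{BB}$ have finite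 entries. Jump chain. $\Omega(\lambda)=(\omega_{ij}(\lambda))$ with $\omega_{ij}(\lambda)=q_{ij}(\lambda)/q_i(\lambda)$ for $i\neq j$ and $\omega_{ii}(\lambda)=0$. It is assumed that $\lim_{\lambda\to\infty}\omega_{ij}(\lambda)$ exists for all $i\ne j$; $\Omega=\lim_{\lambda\to\infty}\Omega(\lambda)$ is a stochastic matrix. Let $\eta=\{\eta_n\}_{n\ge0}$ be the discrete-time Markov chain with transition matrix $\Omega$ and $T_B=\inf\{n\ge0:\eta_n\in B\}$; it is assumed that $P_i(T_B<\infty)=1$ for all $i\in A$. Then $I-\Omega_{AA}$ is invertible. Reduced chain. $Y=\{Y_t:t\ge0\}$ is the continuous-time Markov chain on $B$ with transition rate matrix $\Gamma=Q_{BB}+Q_{BA}(I-\Omega_{AA})^{-1}\Omega_{AB}$; $P_\nu$ denotes its law with initial distribution $\nu$ on $B$. Distributions on $B$ are regarded as distributions on $S$ giving mass $0$ to $A$. Total variation distance: $d_{TV}(\mu,\nu)=\frac12\sum_{i\in S}|\mu_i-\nu_i|$ for probability measures $\mu,\nu$ on $S$. *)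

(* Defs.v *)
From HB Require Import structures.
From mathcomp Require Import all_boot all_order all_algebra.
From mathcomp Require Import all_classical all_reals all_analysis.
Set Implicit Arguments.
Unset Strict Implicit.
Unset Printing Implicit Defensive.
Import Order.TTheory GRing.Theory Num.Theory.
Import numFieldNormedType.Exports.
Local Open Scope classical_set_scope.
Local Open Scope ring_scope.

Definition is_distr (R : realType) (n : nat) (mu : 'rV[R]_n) : Prop :=
  (forall i, 0 <= mu 0 i) /\ \sum_i mu 0 i = 1.

Definition stochastic (R : realType) (n : nat) (M : 'M[R]_n) : Prop :=
  forall i, is_distr (row i M).

Definition rate_matrix (R : realType) (n : nat) (Q : 'M[R]_n) : Prop :=
  (forall i j, i != j -> 0 <= Q i j) /\ (forall i, \sum_j Q i j = 0).

Definition irreducible_rates (R : realType) (n : nat) (Q : 'M[R]_n) : Prop :=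
  forall i j, connect [rel x y | 0 < Q x y] i j.

Definition dTV (R : realType) (n : nat) (mu nu : 'rV[R]_n) : R :=
  2^-1 * \sum_i `|mu 0 i - nu 0 i|.

Definition transition_function (R : realType) (n : nat) (p : R -> 'M[R]_n) :
    Prop :=
  [/\ forall t, 0 <= t -> stochastic (p t),
      p 0 = 1%:M &
      forall s t, 0 <= s -> 0 <= t -> p (s + t) = p s *m p t].

Definition has_rates (R : realType) (n : nat) (p : R -> 'M[R]_n)
    (Q : 'M[R]_n) : Prop :=
  forall i j, (p t i j - (i == j)%:R) / t @[t --> 0^'+] --> Q i j.

(* A process is indexed by R, but only its values at times t >= 0 matter.  The
   Markov property
     P(X_t = j | X_u1 = k1, .., X_um = km, X_s = i) = p_(t-s)(i, j)
   is stated in product form, so that conditioning events of probability 0 need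
   no separate treatment.  No regularity of the sample paths is required. *)
Definition is_ctmc (R : realType) (d : measure_display) (E : measurableType d)
    (n : nat) (P : probability E R) (X : R -> E -> 'I_n)
    (mu : 'rV[R]_n) (Q : 'M[R]_n) : Prop :=
  [/\ forall t i, 0 <= t -> measurable [set w | X t w = i],
      forall i, P [set w | X 0 w = i] = (mu 0 i)%:E &
      exists p : R -> 'M[R]_n,
        [/\ transition_function p,
            has_rates p Q &
            forall (past : seq (R * 'I_n)) (s t : R) (i j : 'I_n),
              (forall u, u \in past -> 0 <= u.1 <= s) -> 0 <= s <= t ->
              let H := [set w | (forall u, u \in past -> X u.1 w = u.2) /\
                                X s w = i] in
              P (H `&` [set w | X t w = j]) = (P H * (p (t - s) i j)%:E)%E]].

Definition law (R : realType) (d : measure_display) (E : measurableType d)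
    (n : nat) (P : probability E R) (X : R -> E -> 'I_n) (t : R) : 'rV[R]_n :=
  \row_i fine (P [set w | X t w = i]).

Definition is_dtmc (R : realType) (d : measure_display) (E : measurableType d)
    (n : nat) (P : probability E R) (eta : nat -> E -> 'I_n)
    (mu : 'rV[R]_n) (W : 'M[R]_n) : Prop :=
  [/\ forall m i, measurable [set w | eta m w = i],
      forall i, P [set w | eta 0%N w = i] = (mu 0 i)%:E &
      forall (m : nat) (x : nat -> 'I_n),
        let H := [set w | forall k, (k <= m)%N -> eta k w = x k] in
        P (H `&` [set w | eta m.+1 w = x m.+1]) =
        (P H * (W (x m) (x m.+1))%:E)%E].

(* +oo when the set is never hit, since the infimum of set0 is +oo *)
Definition hitting_time (R : realType) (E : Type) (n : nat)
    (eta : nat -> E -> 'I_n) (B : pred 'I_n) (w : E) : \bar R :=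
  ereal_inf [set (m%:R)%:E | m in [set m | B (eta m w)]].

Definition exit_rate (R : realType) (n : nat) (Q : 'M[R]_n) (i : 'I_n) : R :=
  - Q i i.

Definition lim_exit_rate (R : realType) (n : nat) (Q : R -> 'M[R]_n)
    (i : 'I_n) : \bar R :=
  lim ((exit_rate (Q l) i)%:E @[l --> +oo]).

Definition fast (R : realType) (n : nat) (Q : R -> 'M[R]_n) : pred 'I_n :=
  fun i => lim_exit_rate Q i == +oo%E.

Definition slow (R : realType) (n : nat) (Q : R -> 'M[R]_n) : pred 'I_n :=
  fun i => (lim_exit_rate Q i < +oo)%E.

Definition lim_rates (R : realType) (n : nat) (Q : R -> 'M[R]_n) :
    'M[\bar R]_n :=
  \matrix_(i, j) lim ((Q l i j)%:E @[l --> +oo]).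

Definition jump_mx (R : realType) (n : nat) (Q : 'M[R]_n) : 'M[R]_n :=
  \matrix_(i, j) if i == j then 0 else Q i j / exit_rate Q i.

Definition lim_jump_mx (R : realType) (n : nat) (Q : R -> 'M[R]_n) : 'M[R]_n :=
  \matrix_(i, j) lim (jump_mx (Q l) i j @[l --> +oo]).

(* From here on the a fast states come first among the a + b states, so the
   block indices A and B are the left/upper and right/lower parts. *)
Definition absorb_mx (R : realType) (a b : nat) (Q : R -> 'M[R]_(a + b)) :
    'M[R]_(a, b) :=
  let W := lim_jump_mx Q in
  invmx (1%:M - ulsubmx W) *m ursubmx W.

(* The slow rows of the limit of Q have finite entries, so fine loses nothing. *)
Definition reduced_rates (R : realType) (a b : nat) (Q : R -> 'M[R]_(a + b)) :
    'M[R]_b :=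
  map_mx fine (drsubmx (lim_rates Q)) +
  map_mx fine (dlsubmx (lim_rates Q)) *m absorb_mx Q.

Definition reduced_distr (R : realType) (a b : nat) (Q : R -> 'M[R]_(a + b))
    (mu : 'rV[R]_(a + b)) : 'rV[R]_b :=
  rsubmx mu + lsubmx mu *m absorb_mx Q.

Definition extend_distr (R : realType) (a b : nat) (nu : 'rV[R]_b) :
    'rV[R]_(a + b) :=
  row_mx 0 nu.

(* Main.v *)
Require Import Defs.
From HB Require Import structures.
From mathcomp Require Import all_boot all_order all_algebra.
From mathcomp Require Import all_classical all_reals all_analysis.
From mathcomp Require Import ring lra.
Set Implicit Arguments.
Unset Strict Implicit.
Unset Printing Implicit Defensive.
Import Order.TTheory GRing.Theory Num.Theory.
Import numFieldNormedType.Exports.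
Local Open Scope classical_set_scope.
Local Open Scope ring_scope.

(* Write W for the limiting jump matrix, M for its fast-to-fast block, V for
   (I - M)^-1 times its fast-to-slow block, U for V stacked on the identity, and
   g for (I - M)^-1 1 stacked on 0.  Almost sure absorption in B gives a minimum
   principle for W: no nonempty set of fast states is closed under W.  Hence
   I - M is invertible, V is stochastic, g >= 0, and on fast states W U = U and
   W g = g - 1.
   Let pi_t be the law of X_t, D_i(l) the exit rates and
   w(t) = \sum_(i fast) pi_t(i) D_i(l).  Since Q(l) = D(l) (Omega(l) - I), for
   large l the drift of g is at most - w / 2 + C; so w has bounded integral,
   although the D_i(l) explode, and the time spent in A vanishes.  As slow states
   are left at a bounded rate, even sup_(t >= h) pi_t(A) tends to 0.
   The function pi_t U solves y' = y Gamma up to an error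
   o(1) (w(t) + 1), because (Omega(l) - I) U tends to 0 on A and Q(l) U tends to
   Gamma on B.  Comparing s |-> pi_s U p^Y(t - s) at s = 0 and s = t shows that
   pi_t U is uniformly close to gamma(pi) p^Y(t), and pi_t U differs from the
   slow part of pi_t by at most pi_t(A).  Integrals are avoided by applying the
   mean value theorem to combinations of these functions with pi_t g. *)

(** * Preliminaries *)

Lemma cvg_sumr (R : realType) (T : Type) (F : set_system T) (I : Type)
    (r : seq I) (f : I -> T -> R) (l : I -> R) : Filter F ->
  (forall i, f i x @[x --> F] --> l i) ->
  \sum_(i <- r) f i x @[x --> F] --> \sum_(i <- r) l i.
Proof.
by move=> FF fl; apply: cvg_big => //; exact: (@add_continuous R).
Qed.

(** The semigroup law gives difference quotients for positive time steps only, so the left quotient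
    is also taken along [h > 0], between [t - h] and [t]. *)
Lemma is_derive_right_left (R : realType) (f : R -> R) (t df : R) :
  (f (t + h) - f t) / h @[h --> 0^'+] --> df ->
  (f t - f (t - h)) / h @[h --> 0^'+] --> df ->
  is_derive t 1 f df.
Proof.
move=> fr fl.
have H : h^-1 *: (f (h *: 1 + t) - f t) @[h --> (0 : R)^'] --> df.
  apply: (@cvg_at_right_left_dnbhs _ R^o).
    apply: cvg_trans fr; apply: near_eq_cvg; near=> h.
    by rewrite /GRing.scale/= mulr1 (addrC h) mulrC.
  apply/cvg_at_leftNP; rewrite oppr0.
  apply: cvg_trans fl; apply: near_eq_cvg; near=> h.
  rewrite /= /GRing.scale/= mulr1 (addrC (- h)) invrN mulNr -mulrN opprB.
  by rewrite mulrC.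
by apply: DeriveDef; [exact: cvgP H | exact: cvg_lim H].
Unshelve. all: by end_near. Qed.

Lemma near_left_gt0 (R : realType) (t : R) : 0 < t ->
  \forall h \near (0 : R)^'+, 0 < t - h.
Proof.
move=> t0; near=> h; rewrite subr_gt0; near: h.
exact: nbhs_right_lt.
Unshelve. all: by end_near. Qed.

Lemma near_gt0 (R : realType) : \forall l \near +oo, (0 : R) < l.
Proof. exact: nbhs_pinfty_gt. Qed.

Lemma forall_near (R : realType) (I : finType) (P : I -> R -> Prop) :
  (forall i, \forall l \near +oo, P i l) ->
  \forall l \near +oo, forall i, P i l.
Proof. by move=> H; apply: filter_forall. Qed.

Lemma le_sum_norm (R : realDomainType) (I : finType) (f : I -> R) i :
  f i <= \sum_j `|f j|.
Proof.
by rewrite (bigD1 i)//= (le_trans (ler_norm _))// lerDl sumr_ge0.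
Qed.

(** Stands in for integrating a bound on the derivative. Only interior points are tested, so the
    kink at 0 of functions of [|s|] does no harm. *)
Lemma increment_le (R : realType) (f df : R -> R) (c x y : R) :
  x <= y -> continuous f ->
  (forall z, x < z < y -> is_derive z 1 f (df z)) ->
  (forall z, x < z < y -> df z <= c) -> f y - f x <= c * (y - x).
Proof.
rewrite le_eqVlt => /predU1P[<- *|xy f_cont f_drv df_le].
  by rewrite !subrr mulr0.
have fd z : z \in `]x, y[ -> is_derive z 1 f (df z).
  by rewrite in_itv/=; exact: f_drv.
have [z + ->] := MVT xy fd (continuous_subspaceT f_cont).
by rewrite in_itv/= => /df_le zc; rewrite ler_wpM2r// subr_ge0 ltW.
Qed.

(** * Transition functions *)

Section TransitionFunction.
Variables (R : realType) (n : nat) (p : R -> 'M[R]_n) (Q : 'M[R]_n).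
Hypotheses (p_tf : transition_function p) (p_rates : has_rates p Q).

Lemma tf_ge0 t i j : 0 <= t -> 0 <= p t i j.
Proof. by case: p_tf => + _ _ => /[apply] /(_ i) [] /(_ j); rewrite mxE. Qed.

Lemma tf_sum1 t i : 0 <= t -> \sum_j p t i j = 1.
Proof.
case: p_tf => + _ _ => /[apply] /(_ i) [] _ <-.
by apply: eq_bigr => j _; rewrite mxE.
Qed.

Lemma tf_le1 t i j : 0 <= t -> p t i j <= 1.
Proof.
move=> t0; rewrite -(tf_sum1 i t0) (bigD1 j)//= lerDl.
by apply: sumr_ge0 => k _; exact: tf_ge0.
Qed.

(** The finitely many difference quotients are eventually within 1 of their limits [Q i j]; this
    tolerance is the summand 1 in [C]. *)
Lemma tf_lipschitz0 : exists C e : R, [/\ 0 < C, 0 < e &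
  forall h i j, 0 <= h < e -> `|p h i j - (i == j)%:R| <= C * h].
Proof.
pose C : R := \sum_i \sum_j `|Q i j| + 1.
have C0 : 0 < C by rewrite ltr_wpDl// sumr_ge0// => i _; rewrite sumr_ge0.
have QC i j : `|Q i j| + 1 <= C.
  rewrite lerD2r (bigD1 i)//= (bigD1 j)//= -addrA lerDl addr_ge0//.
    by rewrite sumr_ge0.
  by rewrite sumr_ge0// => k _; rewrite sumr_ge0.
have : \forall h \near (0 : R)^'+, forall ij : 'I_n * 'I_n,
    `|Q ij.1 ij.2 - (p h ij.1 ij.2 - (ij.1 == ij.2)%:R) / h| <= 1.
  apply: filter_forall => -[i j] /=.
  by have := @p_rates i j; move/cvgrPdist_le; apply.
move=> [e /= e0 He]; exists C, e; split => // h i j /andP[].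
rewrite le_eqVlt => /predU1P[<- _|h0 he].
  by case: p_tf => _ -> _; rewrite mxE subrr normr0 mulr0.
have /(_ (i, j))/= H : forall ij : 'I_n * 'I_n,
    `|Q ij.1 ij.2 - (p h ij.1 ij.2 - (ij.1 == ij.2)%:R) / h| <= 1.
  by apply: He => //=; rewrite sub0r normrN gtr0_norm.
rewrite -ler_pdivrMr// -[X in _ / X](gtr0_norm h0) -normf_div.
rewrite (le_trans _ (QC i j))// -lerBlDl.
by rewrite (le_trans _ H)// (le_trans (lerB_dist _ _))// distrC.
Qed.

(** Taking the short step last leads to the forward equation; [tf_incrl] takes it first, for the
    backward equation. *)
Lemma tf_incrr s h i j : 0 <= s -> 0 <= h ->
  p (s + h) i j - p s i j = \sum_k p s i k * (p h k j - (k == j)%:R).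
Proof.
move=> s0 h0; case: p_tf => _ _ ->//; rewrite mxE.
under [RHS]eq_bigr do rewrite mulrBr.
rewrite sumrB [X in _ = _ - X](bigD1 j)//= eqxx mulr1.
rewrite [X in _ - (_ + X)]big1 ?addr0// => k /negbTE->.
by rewrite mulr0.
Qed.

Lemma tf_incrl s h i j : 0 <= s -> 0 <= h ->
  p (s + h) i j - p s i j = \sum_k (p h i k - (i == k)%:R) * p s k j.
Proof.
move=> s0 h0; rewrite (addrC s); case: p_tf => _ _ ->//; rewrite mxE.
under [RHS]eq_bigr do rewrite mulrBl.
rewrite sumrB [X in _ = _ - X](bigD1 i)//= eqxx mul1r.
rewrite [X in _ - (_ + X)]big1 ?addr0// => k; rewrite eq_sym => /negbTE->.
by rewrite mul0r.
Qed.

(* Extending by [p `|t|] makes the entries continuous on the whole line, which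
   lets the usual calculus apply on closed intervals starting at 0. *)
Lemma tf_continuous i j : continuous (fun t : R => p `|t| i j).
Proof.
have [C [e [C0 e0 HC]]] := tf_lipschitz0.
have le_sh s h : 0 <= s -> 0 <= h < e ->
    `|p (s + h) i j - p s i j| <= n%:R * C * h.
  move=> s0 /[dup] he /andP[h0 _]; rewrite tf_incrr//.
  rewrite (le_trans (ler_norm_sum _ _ _))//.
  rewrite -mulrA mulr_natl -[X in _ *+ X]card_ord -sumr_const.
  apply: ler_sum => k _; rewrite normrM (ger0_norm (tf_ge0 _ _ s0)).
  by rewrite (le_trans _ (HC _ k j he))// ler_piMl// tf_le1.
have le_st s t : 0 <= s -> 0 <= t -> `|s - t| < e ->
    `|p s i j - p t i j| <= n%:R * C * `|s - t|.
  wlog ts : s t / t <= s.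
    move=> H s0 t0; case: (leP t s) => [|/ltW st]; first by move=> *; apply: H.
    by rewrite distrC (distrC (p s i j)) => ste; apply: H.
  move=> s0 t0; have d0 : 0 <= s - t by rewrite subr_ge0.
  rewrite ger0_norm// => ste.
  by have := le_sh t (s - t) t0; rewrite d0 ste (addrC t) subrK => ->.
move=> t; apply/cvgrPdist_le => eps eps0.
have K0 : 0 < n%:R * C + 1 by rewrite ltr_wpDl// mulr_ge0// ltW.
have e1 : 0 < eps / (n%:R * C + 1) by rewrite divr_gt0.
near=> s.
have st : `| `|t| - `|s| | <= `|t - s| by exact: ler_dist_dist.
have se : `|t - s| < e by near: s; exact: cvgr_dist_lt.
have se1 : `|t - s| < eps / (n%:R * C + 1) by near: s; exact: cvgr_dist_lt.
apply: le_trans (le_st _ _ (normr_ge0 _) (normr_ge0 _) (le_lt_trans st se)) _.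
apply: (@le_trans _ _ ((n%:R * C + 1) * `|t - s|)).
  apply: ler_pM => //; first by rewrite mulr_ge0// ltW.
  by rewrite lerDl.
by rewrite -ler_pdivlMl// mulrC ltW.
Unshelve. all: by end_near. Qed.

(** In the left difference quotients at [t] the factor multiplying the rates is [p (t - h)], which
    still moves with [h]. *)
Lemma tf_left_cvg (t : R) i j : 0 < t ->
  p (t - h) i j @[h --> 0^'+] --> p t i j.
Proof.
move=> t0.
have : p `|t - h| i j @[h --> (0 : R)^'+] --> p t i j.
  rewrite -[in X in _ --> X](gtr0_norm t0).
  apply: (@cvg_comp _ _ _ (fun h => t - h) (fun s => p `|s| i j) _ (nbhs t)).
    have : t - h @[h --> (0 : R)^'+] --> t - 0.
      by apply: cvgB; [exact: cvg_cst|exact: cvg_at_right_filter].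
    by rewrite subr0.
  exact: tf_continuous.
apply: cvg_trans; apply: near_eq_cvg; near=> h.
rewrite ger0_norm// ltW//; near: h; exact: near_left_gt0.
Unshelve. all: by end_near. Qed.

(** The right quotient splits [t + h], the left one splits [t] as [(t - h) + h]. The state space is
    finite, so the limit passes through the sum. *)
Lemma tf_forward (t : R) i j : 0 < t ->
  is_derive t 1 (fun s : R => p `|s| i j) ((p t *m Q) i j).
Proof.
move=> t0; have t0' := ltW t0; rewrite mxE; apply: is_derive_right_left.
  have : \sum_k p t i k * ((p h k j - (k == j)%:R) / h) @[h --> 0^'+]
         --> \sum_k p t i k * Q k j.
    by apply: cvg_sumr => k; apply: cvgM; [exact: cvg_cst|exact: p_rates].
  apply: cvg_trans; apply: near_eq_cvg; near=> h.
  have h0 : 0 < h by near: h; exact: nbhs_right_gt.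
  have h0' := ltW h0.
  rewrite !ger0_norm ?addr_ge0//.
  rewrite tf_incrr//.
  by rewrite big_distrl/=; apply: eq_bigr => k _; rewrite mulrA.
have : \sum_k p (t - h) i k * ((p h k j - (k == j)%:R) / h) @[h --> 0^'+]
       --> \sum_k p t i k * Q k j.
  by apply: cvg_sumr => k; apply: cvgM; [exact: tf_left_cvg|exact: p_rates].
apply: cvg_trans; apply: near_eq_cvg; near=> h.
have h0 : 0 < h by near: h; exact: nbhs_right_gt.
have th0 : 0 < t - h by near: h; exact: near_left_gt0.
rewrite !gtr0_norm// -{2}(subrK h t) tf_incrr ?ltW//.
by rewrite big_distrl/=; apply: eq_bigr => k _; rewrite mulrA.
Unshelve. all: by end_near. Qed.

Lemma tf_backward (t : R) i j : 0 < t ->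
  is_derive t 1 (fun s : R => p `|s| i j) ((Q *m p t) i j).
Proof.
move=> t0; have t0' := ltW t0; rewrite mxE; apply: is_derive_right_left.
  have : \sum_k ((p h i k - (i == k)%:R) / h) * p t k j @[h --> 0^'+]
         --> \sum_k Q i k * p t k j.
    by apply: cvg_sumr => k; apply: cvgM; [exact: p_rates|exact: cvg_cst].
  apply: cvg_trans; apply: near_eq_cvg; near=> h.
  have h0 : 0 < h by near: h; exact: nbhs_right_gt.
  have h0' := ltW h0.
  rewrite !ger0_norm ?addr_ge0//.
  rewrite tf_incrl//.
  by rewrite big_distrl/=; apply: eq_bigr => k _; rewrite mulrAC.
have : \sum_k ((p h i k - (i == k)%:R) / h) * p (t - h) k j @[h --> 0^'+]
       --> \sum_k Q i k * p t k j.
  by apply: cvg_sumr => k; apply: cvgM; [exact: p_rates|exact: tf_left_cvg].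
apply: cvg_trans; apply: near_eq_cvg; near=> h.
have h0 : 0 < h by near: h; exact: nbhs_right_gt.
have th0 : 0 < t - h by near: h; exact: near_left_gt0.
rewrite !gtr0_norm// -{2}(subrK h t) tf_incrl ?ltW//.
by rewrite big_distrl/=; apply: eq_bigr => k _; rewrite mulrAC.
Unshelve. all: by end_near. Qed.

End TransitionFunction.

(** * Evolution of laws tested against column vectors *)

Section Flow.
Variables (R : realType) (n : nat) (p : R -> 'M[R]_n) (Q : 'M[R]_n).
Hypotheses (p_tf : transition_function p) (p_rates : has_rates p Q).

Lemma flowE (mu : 'rV[R]_n) (x : 'cV[R]_n) :
  (fun s : R => (mu *m p `|s| *m x) 0 0) =
  \sum_j \sum_i (fun s : R => mu 0 i * x j 0 * p `|s| i j).
Proof.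
apply/funext => s; rewrite mxE fct_sumE; apply: eq_bigr => j _.
rewrite mxE fct_sumE big_distrl/=; apply: eq_bigr => i _.
by rewrite mulrAC.
Qed.

Lemma flow_continuous (mu : 'rV[R]_n) (x : 'cV[R]_n) :
  continuous (fun s : R => (mu *m p `|s| *m x) 0 0).
Proof.
move=> s.
have -> : (fun s : R => (mu *m p `|s| *m x) 0 0) =
  (fun s : R => \sum_j \sum_i mu 0 i * x j 0 * p `|s| i j).
  by rewrite flowE; apply/funext => u; rewrite fct_sumE; apply: eq_bigr => j _;
    rewrite fct_sumE.
apply: cvg_sumr => j; apply: cvg_sumr => i.
by apply: cvgM; [exact: cvg_cst|exact: (tf_continuous p_tf p_rates)].
Qed.

Lemma flow_derive (mu : 'rV[R]_n) (x : 'cV[R]_n) (t : R) : 0 < t ->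
  is_derive t 1 (fun s : R => (mu *m p `|s| *m x) 0 0)
    ((mu *m p t *m Q *m x) 0 0).
Proof.
move=> t0; rewrite flowE.
have -> : (mu *m p t *m Q *m x) 0 0 =
    \sum_j \sum_i mu 0 i * x j 0 * (p t *m Q) i j.
  rewrite -(mulmxA mu) mxE; apply: eq_bigr => j _.
  by rewrite mxE big_distrl/=; apply: eq_bigr => i _; rewrite mulrAC.
apply: is_derive_sum => j; apply: is_derive_sum => i.
exact: (is_deriveZ (mu 0 i * x j 0) (tf_forward p_tf p_rates i j t0)).
Qed.

Lemma flow_distr (mu : 'rV[R]_n) (t : R) : is_distr mu -> 0 <= t ->
  is_distr (mu *m p t).
Proof.
move=> [mu0 mu1] t0; split.
  move=> i; rewrite mxE sumr_ge0// => j _.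
  by rewrite mulr_ge0// (tf_ge0 p_tf).
under eq_bigr do rewrite mxE.
rewrite exchange_big/= -[RHS]mu1; apply: eq_bigr => i _.
by rewrite -mulr_sumr (tf_sum1 p_tf)// mulr1.
Qed.

(** In the forward equation for the entry [(i, i)] the inflow from other states is nonnegative and
    [p i i <= 1], so the derivative is at least [- exit_rate Q i]. *)
Lemma tf_stay (t : R) i : rate_matrix Q -> 0 <= t ->
  1 - exit_rate Q i * t <= p t i i.
Proof.
move=> [Qge0 Qs0] t0.
have Qii : Q i i <= 0.
  move: (Qs0 i); rewrite (bigD1 i)//= => /eqP; rewrite addr_eq0 => /eqP ->.
  by rewrite oppr_le0 sumr_ge0// => k ki; rewrite Qge0// eq_sym.
pose f (s : R) : R := - p `|s| i i.
have f_cont : continuous f.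
  by move=> s; apply: cvgN; exact: (tf_continuous p_tf p_rates).
have f_drv z : 0 < z < t -> is_derive z 1 f (- (p z *m Q) i i).
  move=> /andP[z0 _].
  exact: (is_deriveN (tf_forward p_tf p_rates i i z0)).
have : f t - f 0 <= exit_rate Q i * (t - 0).
  apply: (increment_le t0 f_cont f_drv) => z /andP[z0 _].
  rewrite /exit_rate lerN2 mxE (bigD1 i)//=.
  rewrite -[leLHS]addr0 lerD//.
    by rewrite ler_niMl// (tf_le1 p_tf)// ltW.
  rewrite sumr_ge0// => k ki; rewrite mulr_ge0 ?Qge0//.
  by rewrite (tf_ge0 p_tf)// ltW.
rewrite /f normr0 (ger0_norm t0); case: p_tf => _ -> _; rewrite mxE eqxx/=.
by lra.
Qed.

End Flow.

(** * Estimate at a fixed parameter *)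

Section Estimate.
Variables (R : realType) (a b : nat).
Variables (Q : 'M[R]_(a + b)) (p : R -> 'M[R]_(a + b)).
Variables (G : 'M[R]_b) (pY : R -> 'M[R]_b).
Variables (mu : 'rV[R]_(a + b)) (U : 'M[R]_(a + b, b)) (g : 'cV[R]_(a + b)).
Variables (eps C K L : R).
Hypotheses (mu_distr : is_distr mu) (Q_rates : rate_matrix Q).
Hypotheses (p_tf : transition_function p) (p_rates : has_rates p Q).
Hypotheses (pY_tf : transition_function pY) (pY_rates : has_rates pY G).
Hypotheses (eps_gt0 : 0 < eps) (eps_le1 : eps <= 1).
Hypotheses (C_ge0 : 0 <= C) (K_ge0 : 0 <= K) (L_ge0 : 0 <= L).
Hypothesis U_slow : forall (i k : 'I_b), U (rshift a i) k = (i == k)%:R.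
Hypothesis U_ge0 : forall i k, 0 <= U i k.
Hypothesis U_le1 : forall i k, U i k <= 1.
Hypothesis g_ge0 : forall i, 0 <= g i 0.
Hypothesis g_le : forall i, g i 0 <= L.
Hypothesis UG_le : forall i k, `|(U *m G) i k| <= K.
Hypothesis fast_U :
  forall (i : 'I_a) k,
    `|(Q *m U) (lshift b i) k| <= eps * exit_rate Q (lshift b i).
Hypothesis slow_U :
  forall (i : 'I_b) k,
    `|(Q *m U) (rshift a i) k - (U *m G) (rshift a i) k| <= eps.
Hypothesis fast_g :
  forall i : 'I_a, (Q *m g) (lshift b i) 0 <= - (exit_rate Q (lshift b i) / 2).
Hypothesis slow_g : forall i : 'I_b, (Q *m g) (rshift a i) 0 <= C.
Hypothesis fast_rate :
  forall i : 'I_a, 1 <= eps ^+ 2 * exit_rate Q (lshift b i).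
Hypothesis slow_rate : forall i : 'I_b, exit_rate Q (rshift a i) <= C.

Local Notation pi s := (mu *m p s).

Let w s := \sum_(i < a) pi s 0 (lshift b i) * exit_rate Q (lshift b i).
Let u s := \sum_(i < a) pi s 0 (lshift b i).

Lemma chain_law_ge0 s i : 0 <= s -> 0 <= pi s 0 i.
Proof. by move=> s0; case: (flow_distr p_tf mu_distr s0). Qed.

Lemma chain_law_sum1 s : 0 <= s -> u s + \sum_(k < b) pi s 0 (rshift a k) = 1.
Proof.
by move=> s0; case: (flow_distr p_tf mu_distr s0) => _; rewrite big_split_ord.
Qed.

Lemma fast_mass_ge0 s : 0 <= s -> 0 <= u s.
Proof. by move=> s0; apply: sumr_ge0 => i _; exact: chain_law_ge0. Qed.

Lemma slow_mass_le1 s : 0 <= s -> \sum_(k < b) pi s 0 (rshift a k) <= 1.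
Proof. by move=> s0; rewrite -(chain_law_sum1 s0) lerDr fast_mass_ge0. Qed.

(** The square of [eps] matters: working on a time window of length [eps] will cost one factor, and
    one must remain. *)
Lemma fast_mass_le_flux s : 0 <= s -> u s <= eps ^+ 2 * w s.
Proof.
move=> s0; rewrite mulr_sumr; apply: ler_sum => i _.
by rewrite mulrCA ler_peMr// chain_law_ge0.
Qed.

Lemma fast_flux_ge0 s : 0 <= s -> 0 <= w s.
Proof.
move=> s0; have := le_trans (fast_mass_ge0 s0) (fast_mass_le_flux s0).
by rewrite pmulr_rge0// exprn_gt0.
Qed.

(** Each fast state contributes at most minus half its flux, while the slow states, of total mass at
    most 1, contribute at most [C]. *)
Lemma potential_drift s : 0 <= s -> (pi s *m Q *m g) 0 0 <= - (w s / 2) + C.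
Proof.
move=> s0; rewrite -mulmxA mxE big_split_ord/= lerD//.
  rewrite mulr_suml -sumrN; apply: ler_sum => i _.
  by rewrite -mulrA -mulrN ler_wpM2l// chain_law_ge0.
apply: (@le_trans _ _ (\sum_(k < b) pi s 0 (rshift a k) * C)).
  by apply: ler_sum => i _; rewrite ler_wpM2l// chain_law_ge0.
by rewrite -mulr_suml ler_piMl// slow_mass_le1.
Qed.

Lemma potential_bounds s : 0 <= s -> 0 <= (pi s *m g) 0 0 <= L.
Proof.
move=> s0; rewrite mxE; apply/andP; split.
  by apply: sumr_ge0 => i _; rewrite mulr_ge0// chain_law_ge0.
apply: (@le_trans _ _ (\sum_i pi s 0 i * L)).
  by apply: ler_sum => i _; rewrite ler_wpM2l// chain_law_ge0.
rewrite -mulr_suml; case: (flow_distr p_tf mu_distr s0) => _ ->.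
by rewrite mul1r.
Qed.

(** By [tf_stay], a fraction at least [1 - C * h] of the mass at each slow state is still there
    after time [h], so the slow mass drops by at most [C * h]. *)
Lemma fast_mass_shift s h : 0 <= s -> 0 <= h -> u (s + h) <= u s + C * h.
Proof.
move=> s0 h0; have sh0 := addr_ge0 s0 h0.
pose v s := \sum_(k < b) pi s 0 (rshift a k).
have us : u s = 1 - v s by rewrite -(chain_law_sum1 s0) addrK.
have ush : u (s + h) = 1 - v (s + h) by rewrite -(chain_law_sum1 sh0) addrK.
suff : v s - C * h <= v (s + h) by rewrite us ush; lra.
apply: (@le_trans _ _ (v s * (1 - C * h))).
  have Ch : 0 <= C * h by exact: mulr_ge0.
  have v1 : v s <= 1 by exact: slow_mass_le1.
  by nra.
rewrite mulr_suml; apply: ler_sum => k _.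
case: (p_tf) => _ _ -> //; rewrite mulmxA [leRHS]mxE (bigD1 (rshift a k))//=.
rewrite -[leLHS]addr0 lerD//.
  rewrite ler_wpM2l// ?chain_law_ge0//.
  apply: le_trans (tf_stay p_tf p_rates _ Q_rates h0).
  by rewrite lerB// ler_wpM2r.
by apply: sumr_ge0 => i _; rewrite mulr_ge0 ?chain_law_ge0// (tf_ge0 p_tf).
Qed.

(** If [u t] were large, then by [fast_mass_shift] [u] would be large on all of [[t - eps, t]], and
    [w] larger still by a factor [eps ^- 2]. The potential of [g] would then fall by more than [L],
    although it stays in [[0, L]]. *)
Lemma fast_mass_le t : eps <= t -> u t <= (3 * C + 2 * L) * eps.
Proof.
move=> et; have t0 : 0 < t by exact: lt_le_trans et.
have e2 : 0 < eps ^+ 2 by exact: exprn_gt0.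
(* The drift bound of [potential_drift] with [w] replaced by its lower bound
   [(u t - C * eps) / eps ^+ 2] on the window. *)
pose c := - ((u t - C * eps) / eps ^+ 2 / 2) + C.
have te : t - eps <= t by rewrite lerBlDr lerDl ltW.
have te0 : 0 <= t - eps by rewrite subr_ge0.
pose f (s : R) := (pi `|s| *m g) 0 0.
have f_cont : continuous f by exact: (flow_continuous p_tf p_rates).
have f_drv z : t - eps < z < t -> is_derive z 1 f ((pi z *m Q *m g) 0 0).
  by move=> /andP[z1 _]; apply: flow_derive => //; exact: le_lt_trans z1.
have : f t - f (t - eps) <= c * (t - (t - eps)).
  apply: (increment_le te f_cont f_drv).
  move=> z /andP[z1 z2]; have z0 : 0 <= z by rewrite ltW// (le_lt_trans te0).
  apply: (le_trans (potential_drift z0)); rewrite lerD2r lerN2 ler_wpM2r//.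
  rewrite ler_pdivrMr// (mulrC (w z)).
  apply: le_trans (fast_mass_le_flux z0); rewrite lerBlDr.
  have zt : 0 <= t - z by rewrite subr_ge0 ltW.
  have := fast_mass_shift z0 zt; rewrite addrC subrK => /le_trans; apply.
  by rewrite lerD2l ler_wpM2l//; lra.
rewrite /f !ger0_norm//; last exact: ltW.
have /andP[+ _] := potential_bounds (ltW t0).
have /andP[_ +] := potential_bounds te0.
set ft := (_ *m g) 0 0; set fe := (_ *m g) 0 0 => fe_le ft_ge.
have -> : c * (t - (t - eps)) = - ((u t - C * eps) / (2 * eps)) + C * eps.
  by rewrite /c; field; rewrite gt_eqF.
move=> H.
have : (u t - C * eps) / (2 * eps) <= L + C * eps by lra.
rewrite ler_pdivrMr ?mulr_gt0// => H'.
have : eps * (C * eps) <= C * eps by rewrite ler_piMl// mulr_ge0// ltW.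
by lra.
Qed.

(** On fast states [Q *m U] costs [eps * w] and [U *m G] costs [K * u], which is at most
    [K * eps * w] because [u <= eps ^+ 2 * w] and [eps <= 1]. Slow states cost [eps] in total. *)
Lemma drift_U s k : 0 <= s ->
  `|(pi s *m (Q *m U - U *m G)) 0 k| <= eps * (1 + K) * w s + eps.
Proof.
move=> s0.
have subE i : (Q *m U - U *m G) i k = (Q *m U) i k - (U *m G) i k.
  by rewrite [LHS]mxE [X in _ + X]mxE.
rewrite mxE (le_trans (ler_norm_sum _ _ _))//.
rewrite big_split_ord/= lerD//.
  apply: (@le_trans _ _ (eps * w s + K * u s)).
    rewrite !mulr_sumr -big_split/=; apply: ler_sum => i _.
    rewrite normrM ger0_norm ?chain_law_ge0// subE.
    rewrite mulrCA (mulrC K) -mulrDr ler_wpM2l ?chain_law_ge0//.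
    by rewrite (le_trans (ler_normB _ _))// lerD.
  have := fast_mass_le_flux s0; have := fast_flux_ge0 s0.
  have : eps ^+ 2 <= eps by rewrite expr2 ler_piMl// ltW.
  move=> e2 w0 uw.
  have : K * u s <= K * (eps * w s).
    by rewrite ler_wpM2l// (le_trans uw)// ler_wpM2r.
  by lra.
apply: (@le_trans _ _ (\sum_(k < b) pi s 0 (rshift a k) * eps)).
  apply: ler_sum => i _; rewrite normrM ger0_norm ?chain_law_ge0//.
  rewrite ler_wpM2l ?chain_law_ge0//.
  by rewrite subE.
by rewrite -mulr_suml ler_piMl ?slow_mass_le1// ltW.
Qed.

(* Interpolates between [pi t *m U] at [s = t] and [mu *m U *m pY t] at
   [s = 0]. *)
Let r k (t s : R) := \sum_(j < b) (pi `|s| *m col j U) 0 0 * pY `|t - s| j k.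

Lemma interp_continuous k (t : R) : continuous (r k t).
Proof.
move=> s; apply: cvg_sumr => j; apply: cvgM.
  exact: (flow_continuous p_tf p_rates).
apply: (@cvg_comp _ _ _ (fun s : R => t - s) (fun s : R => pY `|s| j k) _
  (nbhs (t - s))).
  by apply: cvgB; [exact: cvg_cst|exact: cvg_id].
exact: (tf_continuous pY_tf pY_rates).
Qed.

(** Product rule with the forward equation for [p] and the backward equation for [pY]. Reversing
    time in [pY] gives the minus sign, so only the defect [Q *m U - U *m G] remains between the two
    semigroups. *)
Lemma interp_derive k (t s : R) : 0 < s < t ->
  is_derive s 1 (r k t) ((pi s *m (Q *m U - U *m G) *m pY (t - s)) 0 k).
Proof.
move=> /andP[s0 st]; have ts0 : 0 < t - s by rewrite subr_gt0.
have rE : r k t = \sum_(j < b)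
    ((fun s : R => (pi `|s| *m col j U) 0 0) *
     ((fun s : R => pY `|s| j k) \o (fun s : R => t - s))).
  by apply/funext => x; rewrite fct_sumE.
have -> : (pi s *m (Q *m U - U *m G) *m pY (t - s)) 0 k =
  \sum_(j < b) ((pi `|s| *m col j U) 0 0 *: ((G *m pY (t - s)) j k * - 1) +
     (pY `|t - s| j k) *: (pi s *m Q *m col j U) 0 0).
  rewrite !gtr0_norm// big_split/= mulmxBr mulmxBl !mulmxA mxE addrC.
  congr (_ + _).
    rewrite mxE -mulmxA mxE -sumrN; apply: eq_bigr => j _.
    rewrite /GRing.scale/= mulrN1 mulrN; congr (- (_ * _)).
    by rewrite !mxE; apply: eq_bigr => i _; rewrite !mxE.
  rewrite mxE; apply: eq_bigr => j _; rewrite /GRing.scale/= mulrC.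
  congr (_ * _).
  by rewrite !mxE; apply: eq_bigr => i _; rewrite !mxE.
rewrite rE; apply: is_derive_sum => j; apply: is_deriveM.
  exact: flow_derive.
apply: is_derive1_comp; first exact: (tf_backward pY_tf pY_rates).
rewrite -[- 1]add0r; apply: is_deriveB.
Qed.

(** The derivative of [r] is bounded only in terms of [w], which has no uniform bound. Adding a
    multiple of the potential of [g] cancels [w], at the price of a bounded boundary term. *)
Lemma interp_increment k (t : R) : 0 <= t ->
  `|r k t t - r k t 0| <=
  (b%:R * (t + 2 * (1 + K) * (C * t + L))) * eps.
Proof.
move=> t0.
(* Chosen so that the decrease [M * w / 2] of the potential equals the term [b * eps * (1 + K) * w]
   in the bound on the derivative of [r]. *)
pose M := 2 * b%:R * eps * (1 + K).
have M0 : 0 <= M by rewrite !mulr_ge0// ?addr_ge0// ltW.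
pose f (s : R) := (pi `|s| *m g) 0 0.
have f_cont : continuous f by exact: (flow_continuous p_tf p_rates).
have rs_le s : 0 < s < t ->
    `|(pi s *m (Q *m U - U *m G) *m pY (t - s)) 0 k| <=
    b%:R * (eps * (1 + K) * w s + eps).
  move=> /andP[s0 st]; rewrite mxE (le_trans (ler_norm_sum _ _ _))//.
  rewrite mulr_natl -[X in _ *+ X]card_ord -sumr_const; apply: ler_sum => j _.
  have ts0 : 0 <= t - s by rewrite subr_ge0 ltW.
  rewrite normrM -[leRHS]mulr1 ler_pM//; first exact/drift_U/ltW.
  by rewrite ger0_norm ?(tf_ge0 pY_tf)// (tf_le1 pY_tf).
(* A one-sided bound for each sign [sg] yields the absolute value. *)
have main (sg : R) : `|sg| = 1 ->
    sg * (r k t t - r k t 0) <= (b%:R * eps + M * C) * t + M * L.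
  move=> sg1.
  pose F (s : R) := sg * r k t s + M * f s.
  have F_cont : continuous F.
    move=> s; apply: cvgD; apply: cvgM; try exact: cvg_cst.
      exact: interp_continuous.
    exact: f_cont.
  have F_drv z : 0 < z < t -> is_derive z 1 F
      (sg * (pi z *m (Q *m U - U *m G) *m pY (t - z)) 0 k +
       M * (pi z *m Q *m g) 0 0).
    move=> zt; have /andP[z0 _] := zt.
    exact: (is_deriveD (is_deriveZ sg (interp_derive k zt))
      (is_deriveZ M (flow_derive p_tf p_rates mu g z0))).
  have : F t - F 0 <= (b%:R * eps + M * C) * (t - 0).
    apply: (increment_le t0 F_cont F_drv) => z zt; have /andP[z0 _] := zt.
    have := rs_le _ zt; have := potential_drift (ltW z0).
    set e := (_ *m pY _) 0 k; set d := (_ *m g) 0 0 => dle ele.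
    have : sg * e <= `|e|.
      by rewrite -[leRHS]mul1r -sg1 -normrM ler_norm.
    have : M * d <= M * (- (w z / 2) + C) by rewrite ler_wpM2l.
    by rewrite /M; lra.
  rewrite /F subr0 => H.
  have fL s : 0 <= s -> 0 <= f s <= L.
    by move=> s0; rewrite /f ger0_norm//; exact: potential_bounds.
  have /andP[ft0 _] := fL _ t0; have /andP[_ f0L] := fL 0 (lexx _).
  have := ler_wpM2l M0 f0L; have := mulr_ge0 M0 ft0.
  by lra.
have -> : (b%:R * (t + 2 * (1 + K) * (C * t + L))) * eps =
   (b%:R * eps + M * C) * t + M * L by rewrite /M; ring.
rewrite ler_norml; apply/andP; split.
  by have := main (-1); rewrite normrN1 => /(_ erefl); lra.
by have := main 1; rewrite normr1 => /(_ erefl); lra.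
Qed.

(** The fast coordinates contribute [u t]. Each slow one contributes at most [u t], for replacing
    [pi t] by [pi t *m U], plus the increment of [r]. The factor 1/2 is given away. *)
Lemma dTV_le t : eps <= t ->
  dTV (pi t) (extend_distr a (mu *m U *m pY t)) <=
  ((1 + b%:R) * (3 * C + 2 * L) +
   b%:R * (b%:R * (t + 2 * (1 + K) * (C * t + L)))) * eps.
Proof.
move=> et; have t0 : 0 <= t by rewrite (le_trans _ et)// ltW.
have ut := fast_mass_le et; have ut0 := fast_mass_ge0 t0.
set N := t + _.
rewrite /dTV big_split_ord/=.
have -> : \sum_(i < a) `|pi t 0 (lshift b i) -
    (extend_distr a (mu *m U *m pY t)) 0 (lshift b i)| = u t.
  apply: eq_bigr => i _; rewrite /extend_distr row_mxEl [X in _ - X]mxE subr0.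
  by rewrite ger0_norm// chain_law_ge0.
have slow_le (k : 'I_b) : `|pi t 0 (rshift a k) -
    (extend_distr a (mu *m U *m pY t)) 0 (rshift a k)| <=
    u t + b%:R * N * eps.
  rewrite /extend_distr row_mxEr.
  (* As [pY 0] and the slow rows of [U] are identities, [r k t t] is the slow mass at [k] plus what
     the fast states send there. *)
  have rt : r k t t = pi t 0 (rshift a k) +
      \sum_(i < a) pi t 0 (lshift b i) * U (lshift b i) k.
    have pY0 j : pY 0 j k = (j == k)%:R.
      by case: pY_tf => _ -> _; rewrite mxE.
    rewrite /r subrr normr0 (ger0_norm t0) (bigD1 k)//= big1 => [|j jk].
      rewrite pY0 eqxx mulr1 addr0.
      rewrite mxE big_split_ord/= addrC; congr (_ + _); last first.
        by apply: eq_bigr => i _; rewrite [col _ _ _ _]mxE.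
      rewrite (bigD1 k)//= [col _ _ _ _]mxE U_slow eqxx mulr1.
      rewrite big1 ?addr0// => j jk.
      by rewrite [col _ _ _ _]mxE U_slow (negbTE jk) mulr0.
    by rewrite pY0 (negbTE jk) mulr0.
  have r0 : r k t 0 = (mu *m U *m pY t) 0 k.
    rewrite /r subr0 normr0 (ger0_norm t0) mxE; apply: eq_bigr => j _.
    case: (p_tf) => _ -> _; rewrite mulmx1; congr (_ * _).
    by rewrite !mxE; apply: eq_bigr => i _; rewrite mxE.
  have := interp_increment k t0; rewrite rt r0 -/N.
  have : 0 <= \sum_(i < a) pi t 0 (lshift b i) * U (lshift b i) k <= u t.
    apply/andP; split.
      by apply: sumr_ge0 => i _; rewrite mulr_ge0// chain_law_ge0.
    by apply: ler_sum => i _; rewrite ler_piMr// chain_law_ge0.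
  move=> /andP[]; set S := \sum_(i < a) _ => S0 Su.
  by rewrite !ler_norml => /andP[? ?]; apply/andP; split; lra.
have : \sum_(k < b) `|pi t 0 (rshift a k) -
    (extend_distr a (mu *m U *m pY t)) 0 (rshift a k)| <=
    b%:R * (u t + b%:R * N * eps).
  rewrite mulr_natl -[X in _ *+ X]card_ord -sumr_const.
  by apply: ler_sum => k _.
have := ler_wpM2l (ler0n R b) ut.
have : 0 <= \sum_(k < b) `|pi t 0 (rshift a k) -
    (extend_distr a (mu *m U *m pY t)) 0 (rshift a k)|.
  exact: sumr_ge0.
by lra.
Qed.

End Estimate.

(** * Probabilistic input *)

Lemma measure_fin_split (R : realType) (d : measure_display)
    (E : measurableType d) (P : {measure set E -> \bar R}) (I : finType)
    (f : E -> I) (A : set E) :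
  (forall i, measurable [set w | f w = i]) -> measurable A ->
  P A = \sum_i P ([set w | f w = i] `&` A).
Proof.
move=> fm Am; pose F i := [set w | f w = i] `&` A.
have -> : \sum_i P (F i) = \sum_(i \in [set: I]) P (F i).
  rewrite [LHS]fsbig_seq ?index_enum_uniq//; apply: eq_fsbigl.
  by apply/seteqP; split => // i _ /=; exact: mem_index_enum.
rewrite -measure_fin_bigcup//.
- congr (P _); apply/seteqP; split => [w Aw|w [i _ []]//].
  by exists (f w).
- exact: finite_finset.
- by move=> i j _ _ [w [[<- _] [<- _]]].
- by move=> i _; exact: measurableI.
Qed.

(** From here on the processes enter only through their transition functions. *)
Lemma law_flow (R : realType) (d : measure_display) (E : measurableType d)
    (n : nat) (P : probability E R) (X : R -> E -> 'I_n)
    (mu : 'rV[R]_n) (Q : 'M[R]_n) :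
  is_ctmc P X mu Q ->
  exists p, [/\ transition_function p, has_rates p Q &
    forall t, 0 <= t -> law P X t = mu *m p t].
Proof.
move=> [mX X0 [p [p_tf p_rates markov]]]; exists p; split => // t t0.
apply/rowP => j; rewrite !mxE.
rewrite (measure_fin_split P (f := X 0))//; [|by move=> i; exact: mX|exact: mX].
rewrite [X in fine X](_ : _ = (\sum_i mu 0 i * p t i j)%:E)//.
rewrite -sumEFin; apply: eq_bigr => i _.
(* An empty past and present time 0 turn the Markov property into a conditioning on the initial
   state. *)
have := markov [::] 0 t i j; rewrite lexx t0 subr0/= => H.
have HE : [set w | (forall u, u \in [::] -> X u.1 w = u.2) /\ X 0 w = i] =
    [set w | X 0 w = i] by apply/seteqP; split => w [].
by rewrite EFinM -X0 -HE -H// => u; rewrite in_nil.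
Qed.

(** A trajectory leaving [Z] has a finite initial path whose last step has weight 0 in [W]. There
    are countably many finite paths, and each such path has probability 0. *)
Lemma dtmc_closed (R : realType) (d : measure_display) (E : measurableType d)
    (n : nat) (P : probability E R) (eta : nat -> E -> 'I_n) (i : 'I_n)
    (W : 'M[R]_n) (Z : pred 'I_n) :
  is_dtmc P eta (delta_mx 0 i) W -> Z i ->
  (forall x y, Z x -> ~~ Z y -> W x y = 0) ->
  P.-negligible [set w | exists m, ~~ Z (eta m w)].
Proof.
move=> [m_eta eta0 markov] Zi Zclosed.
pose H m (x : nat -> 'I_n) := [set w | forall k, (k <= m)%N -> eta k w = x k].
(* [unpickle] enumerates the finite words. A word of length [m + 2] lists the states at times 0 to
   [m + 1], hence the [.-2]; words with a possible last step and numbers coding no word give the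
   empty set. *)
pose N (c : nat) : set E := if unpickle c is Some s then
    let x := nth i s in let m := (size s).-2 in
    if W (x m) (x m.+1) == 0 then H m x `&` [set w | eta m.+1 w = x m.+1]
    else set0
  else set0.
have mH m x : measurable (H m x).
  rewrite [X in measurable X](_ : _ =
    \bigcap_(k in [set k | (k <= m)%N]) [set w | eta k w = x k]).
    by apply: bigcap_measurableType => k _; exact: m_eta.
  by apply/seteqP; split.
have N0 c : P.-negligible (N c).
  rewrite /N; case: unpickle => [s|]; last exact: negligible_set0.
  case: ifPn => [/eqP W0|_]; last exact: negligible_set0.
  apply/negligibleP; first exact: measurableI.
  by have := markov (size s).-2 (nth i s); rewrite /= W0 mule0.
have I0 : P.-negligible (~` [set w | eta 0%N w = i]).
  apply/negligibleP; first exact/measurableC/m_eta.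
  by have := probability_setC P (m_eta 0%N i); rewrite eta0 mxE !eqxx subee.
apply: negligibleS (negligibleU I0 (negligible_bigcup N0)) => w [m0 Zm0].
have [w0|w0] := pselect (eta 0%N w = i); [right|by left].
apply: contrapT => notN; move/negP: Zm0; apply.
suff Zm m k : (k <= m)%N -> Z (eta k w) by exact: (Zm m0).
elim: m k => [|m IH] k.
  by rewrite leqn0 => /eqP ->; rewrite w0.
rewrite leq_eqVlt => /predU1P[->|]; last by rewrite ltnS; exact: IH.
apply/negPn/negP => nZ; apply: notN.
(* The trajectory up to its first exit from [Z], at time [m + 1]. *)
pose s := mkseq (fun k => eta k w) m.+2.
exists (pickle s) => //; rewrite /N pickleK size_mkseq.
rewrite -[m.+2.-2]/m !nth_mkseq//.
rewrite Zclosed ?eqxx//; last exact: IH.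
split=> [k' k'm|] //.
by rewrite /s nth_mkseq// ltnS leqW.
Qed.

(** Otherwise [Z] is closed under [W], so the chain started at [i] almost surely stays in [Z] and
    never visits [B]. *)
Lemma never_trapped (R : realType) (d : measure_display) (E : measurableType d)
    (n : nat) (P : probability E R) (eta : nat -> E -> 'I_n) (i : 'I_n)
    (W : 'M[R]_n) (B Z : pred 'I_n) :
  is_dtmc P eta (delta_mx 0 i) W ->
  P [set w | (hitting_time R eta B w < +oo)%E] = 1%E ->
  Z i -> (forall x, Z x -> ~~ B x) ->
  exists x y, [/\ Z x, ~~ Z y & W x y != 0].
Proof.
move=> eta_dtmc hit Zi ZB; apply: contrapT => trapped.
have Zclosed x y : Z x -> ~~ Z y -> W x y = 0.
  move=> Zx Zy; apply/eqP/negPn/negP => Wxy.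
  by apply: trapped; exists x, y.
(* Writing the event as a countable union of cylinders shows that it is measurable. *)
have hitE : [set w | (hitting_time R eta B w < +oo)%E] =
    \bigcup_m \bigcup_(j in [set j | B j]) [set w | eta m w = j].
  apply/seteqP; split => w /=.
    rewrite /hitting_time => fin_hit; apply: contrapT => noB.
    have S0 : [set (m%:R : R)%:E | m in [set m | B (eta m w)]] = set0.
      apply/seteqP; split => // x [m Bm mx].
      by apply: noB; exists m => //; exists (eta m w).
    by move: fin_hit; rewrite S0 ereal_inf0 ltxx.
  move=> [m _ [j Bj mj]]; apply: (@le_lt_trans _ _ m%:R%:E); last exact: ltry.
  by apply: ereal_inf_lbound; exists m => //=; rewrite mj.
have mhit : measurable [set w | (hitting_time R eta B w < +oo)%E].
  rewrite hitE; apply: bigcupT_measurable => m.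
  by apply: fin_bigcup_measurable => // j _; case: eta_dtmc.
have : P.-negligible [set w | (hitting_time R eta B w < +oo)%E].
  apply: negligibleS (dtmc_closed eta_dtmc Zi Zclosed); rewrite hitE.
  move=> w [m _ [j Bj mj]]; exists m; apply/negP => /ZB.
  by rewrite mj Bj.
move=> /(measure_negligible mhit) hit0.
have : (1 = 0 :> \bar R)%E by rewrite -hit -[RHS]hit0.
by move/eqP; rewrite onee_eq0.
Qed.

(** Suppose the minimum is negative and let [Z] be the set of minimizers, which avoids [B]. On [Z]
    the [W]-average is at most the minimum, so all positive weight goes to minimizers; then [Z] is
    closed, which [no_trap] forbids. *)
Lemma min_principle (R : realType) (n : nat) (W : 'M[R]_n) (B : pred 'I_n)
    (x : 'cV[R]_n) :
  stochastic W ->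
  (forall Z : pred 'I_n, (exists i, Z i) -> (forall i, Z i -> ~~ B i) ->
     exists i j, [/\ Z i, ~~ Z j & W i j != 0]) ->
  (forall i, B i -> 0 <= x i 0) ->
  (forall i, ~~ B i -> (W *m x) i 0 <= x i 0) ->
  forall i, 0 <= x i 0.
Proof.
move=> W_st no_trap xB xW i; rewrite leNgt; apply/negP => xi.
have [k _ k_min] := @arg_minP _ _ _ i xpredT (fun i => x i 0) isT.
have xk : x k 0 < 0 by exact: le_lt_trans (k_min i isT) xi.
pose Z : pred 'I_n := fun j => x j 0 == x k 0.
have [|j /eqP xj|j [l [/eqP xj xl]]] := no_trap Z.
- by exists k; rewrite /Z eqxx.
- by apply/negP => /xB; rewrite xj leNgt xk.
have W0 i' j' : 0 <= W i' j'.
  by have [] := W_st i'; move=> /(_ j'); rewrite mxE.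
have W1 i' : \sum_j' W i' j' = 1.
  by have [_ <-] := W_st i'; apply: eq_bigr => j' _; rewrite mxE.
have jB : ~~ B j by apply/negP => /xB; rewrite xj leNgt xk.
have S0 : \sum_m W j m * (x m 0 - x k 0) = 0.
  apply/eqP; rewrite eq_le; apply/andP; split; last first.
    by apply: sumr_ge0 => m _; rewrite mulr_ge0// subr_ge0 k_min.
  under eq_bigr do rewrite mulrBr.
  rewrite sumrB -mulr_suml W1 mul1r subr_le0 -xj.
  by have := xW _ jB; rewrite mxE.
apply/negP; rewrite negbK.
have /eqP := S0; rewrite psumr_eq0 => [/allP/(_ l (mem_index_enum _))|m _].
  by rewrite mulf_eq0 subr_eq0 [x l 0 == _](negbTE xl) orbF.
by rewrite mulr_ge0// subr_ge0 k_min.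
Qed.

(** * Absorption of the jump chain in the slow states *)

Section Absorption.
Variables (R : realType) (a b : nat) (W : 'M[R]_(a + b)).
Hypothesis W_min : forall x : 'cV[R]_(a + b),
  (forall i : 'I_b, 0 <= x (rshift a i) 0) ->
  (forall i : 'I_a, (W *m x) (lshift b i) 0 <= x (lshift b i) 0) ->
  forall i, 0 <= x i 0.

Local Notation I_M := (1%:M - ulsubmx W).
(** For the jump chain with matrix [W], [V] is the distribution of the entrance state in B and [g0]
    the mean number of jumps until entrance, as functions of the fast starting state. *)
Let V : 'M[R]_(a, b) := invmx I_M *m ursubmx W.
Let g0 : 'cV[R]_a := invmx I_M *m const_mx 1.

Lemma mul_col_lshift m (y : 'M[R]_(a, m)) (z : 'M[R]_(b, m)) i k :
  (W *m col_mx y z) (lshift b i) k = (ulsubmx W *m y + ursubmx W *m z) i k.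
Proof. by rewrite -{1}(submxK W) mul_block_col col_mxEu. Qed.

(** A vector in the kernel, extended by 0 to slow states, is harmonic on fast states; the minimum
    principle for it and its opposite makes it vanish. *)
Lemma absorb_unit : I_M \in unitmx.
Proof.
have inj (y : 'cV[R]_a) : I_M *m y = 0 -> forall i, 0 <= y i 0.
  rewrite mulmxBl mul1mx => /eqP; rewrite subr_eq0 => /eqP y0 i.
  have := W_min (x := col_mx y 0) _ _ (lshift b i); rewrite col_mxEu; apply.
    by move=> j; rewrite col_mxEd mxE.
  by move=> j; rewrite mul_col_lshift mulmx0 addr0 col_mxEu -y0.
rewrite -unitmx_tr -row_free_unit; apply: inj_row_free => v v0.
have : I_M *m v^T = 0 by apply/trmx_inj; rewrite trmx_mul trmxK v0 trmx0.
move=> H; have := inj _ H; have := inj (- v^T).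
rewrite mulmxN H oppr0 => /(_ erefl) vle vge.
apply/rowP => i; apply/eqP; rewrite mxE eq_le.
by have := vle i; have := vge i; rewrite !mxE oppr_ge0 => -> ->.
Qed.

Lemma absorb_harmonic i k :
  (W *m col_mx V 1%:M) (lshift b i) k = (col_mx V 1%:M) (lshift b i) k.
Proof.
rewrite mul_col_lshift mulmx1 col_mxEu; congr (fun_of_matrix _ i k).
have -> : ursubmx W = I_M *m V by rewrite mulKVmx// absorb_unit.
by rewrite mulmxBl mul1mx addrC subrK.
Qed.

Lemma absorb_ge0 i k : 0 <= (col_mx V 1%:M) i k.
Proof.
have colW m (A : 'M[R]_(a + b, m)) j l : (W *m col l A) j 0 = (W *m A) j l.
  by rewrite !mxE; apply: eq_bigr => ? _; rewrite mxE.
have := W_min (x := col k (col_mx V 1%:M)) _ _ i; rewrite mxE; apply => j.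
  by rewrite mxE col_mxEd mxE ler0n.
by rewrite colW absorb_harmonic [leRHS]mxE.
Qed.

(** The row sums of [U] minus 1 vanish on slow states and are harmonic on fast ones, so the minimum
    principle applies with both signs. *)
Lemma absorb_sum1 i : (forall j, \sum_l W j l = 1) ->
  \sum_k (col_mx V 1%:M) i k = 1.
Proof.
move=> W1; set U := col_mx V 1%:M.
pose x : 'cV[R]_(a + b) := U *m const_mx 1 - const_mx 1.
have W_cst j : (W *m const_mx 1 : 'cV[R]_(a + b)) j 0 = 1.
  by rewrite mxE -[RHS](W1 j); apply: eq_bigr => l _; rewrite mxE mulr1.
have U1 j : (U *m const_mx 1 : 'cV[R]_(a + b)) j 0 = \sum_k U j k.
  by rewrite mxE; apply: eq_bigr => k _; rewrite [const_mx _ _ _]mxE mulr1.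
have xE j : x j 0 = \sum_k U j k - 1.
  by rewrite /x [LHS]mxE U1 [X in _ + X]mxE [const_mx _ _ _]mxE.
have xB j : x (rshift a j) 0 = 0.
  rewrite xE (bigD1 j)//= big1 => [|k kj]; rewrite col_mxEd mxE.
    by rewrite eqxx addr0 subrr.
  by rewrite eq_sym (negbTE kj).
have xA j : (W *m x) (lshift b j) 0 = x (lshift b j) 0.
  rewrite xE mulmxBr mulmxA [LHS]mxE [X in _ + X]mxE W_cst; congr (_ - _).
  rewrite mxE; apply: eq_bigr => k _.
  by rewrite absorb_harmonic [const_mx _ _ _]mxE mulr1.
have x_ge0 : 0 <= x i 0.
  by apply: W_min => j; rewrite ?xB ?xA.
have oppE m (A : 'cV[R]_m) j : (- A) j 0 = - A j 0 by rewrite mxE.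
have x_le0 : 0 <= (- x) i 0.
  by apply: W_min => j; rewrite ?mulmxN !oppE ?xB ?oppr0 ?xA.
apply/eqP; rewrite -subr_eq0 -xE eq_le x_ge0 andbT.
by rewrite -oppr_ge0 -oppE.
Qed.

Lemma hitting_steps i :
  (W *m col_mx g0 0) (lshift b i) 0 = (col_mx g0 0) (lshift b i) 0 - 1.
Proof.
rewrite mul_col_lshift mulmx0 addr0 col_mxEu.
have -> : ulsubmx W *m g0 = g0 - const_mx 1.
  rewrite -[X in g0 - X](mulKVmx absorb_unit) mulmxBl mul1mx opprB addrC subrK.
  by [].
by rewrite [LHS]mxE [X in _ + X]mxE [const_mx _ _ _]mxE.
Qed.

Lemma hitting_steps_ge0 i : 0 <= (col_mx g0 0 : 'cV[R]_(a + b)) i 0.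
Proof.
apply: W_min => j; first by rewrite col_mxEd mxE.
by rewrite hitting_steps lerBlDr lerDl.
Qed.

End Absorption.

(** * Limits of rates and jump probabilities *)

Section Limits.
Variables (R : realType) (a b : nat) (Q : R -> 'M[R]_(a + b)).
Hypotheses (Q_rates : forall l, 0 < l -> rate_matrix (Q l))
  (Q_lim : forall i j, i != j -> cvg ((Q l i j)%:E @[l --> +oo]))
  (A_first : forall i : 'I_(a + b), fast Q i = (i < a)%N)
  (B_pos : forall i, slow Q i -> (0 < lim_exit_rate Q i)%E)
  (W_lim : forall i j, i != j -> cvg (jump_mx (Q l) i j @[l --> +oo])).

Let W := lim_jump_mx Q.

Lemma exit_rateE l i : 0 < l -> exit_rate (Q l) i = \sum_(j | j != i) Q l i j.
Proof.
move=> /Q_rates[_ /(_ i)]; rewrite (bigD1 i)//= => /eqP.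
by rewrite addrC addr_eq0 => /eqP ->.
Qed.

Lemma offdiag_ge0 l i j : 0 < l -> i != j -> 0 <= Q l i j.
Proof. by move=> /Q_rates[+ _]; apply. Qed.

Lemma exit_rate_ge0 l i : 0 < l -> 0 <= exit_rate (Q l) i.
Proof.
move=> l0; rewrite exit_rateE// sumr_ge0// => j ji.
by rewrite offdiag_ge0// eq_sym.
Qed.

Lemma rate_le_exit l i j : 0 < l -> i != j -> Q l i j <= exit_rate (Q l) i.
Proof.
move=> l0 ij; rewrite exit_rateE// (bigD1 j) 1?eq_sym//= lerDl sumr_ge0//.
by move=> k /andP[ki _]; rewrite offdiag_ge0// eq_sym.
Qed.

(** Convergence is assumed off the diagonal only. Nonnegativity of these rates lets their possibly
    infinite limits be added. *)
Lemma exit_rate_cvg i :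
  (exit_rate (Q l) i)%:E @[l --> +oo] --> lim_exit_rate Q i.
Proof.
have : (\sum_(j | j != i) (Q l i j)%:E)%E @[l --> +oo] -->
    (\sum_(j | j != i) lim ((Q l i j)%:E @[l --> +oo%R]))%E.
  apply: cvg_nnesum => j ji; last by apply: Q_lim; rewrite eq_sym.
  apply: filterS (@near_gt0 R) => l l0.
  by rewrite lee_fin offdiag_ge0// eq_sym.
move=> H; suff : (exit_rate (Q l) i)%:E @[l --> +oo] -->
    (\sum_(j | j != i) lim ((Q l i j)%:E @[l --> +oo%R]))%E by exact: cvgP.
apply: cvg_trans H; apply: near_eq_cvg; near=> l.
rewrite sumEFin exit_rateE//; near: l; exact: near_gt0.
Unshelve. all: by end_near. Qed.

Lemma fast_exit_rate (i : 'I_a) (A : R) :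
  \forall l \near +oo, A <= exit_rate (Q l) (lshift b i).
Proof.
have /eqP iy : fast Q (lshift b i) by rewrite A_first /= ltn_ord.
have := @exit_rate_cvg (lshift b i); rewrite iy => /cvgeyPge/(_ A).
by apply: filterS => l; rewrite lee_fin.
Qed.

Lemma slow_exit_rate (i : 'I_b) :
  exists2 r : R, 0 < r & exit_rate (Q l) (rshift a i) @[l --> +oo] --> r.
Proof.
have i_slow : slow Q (rshift a i).
  rewrite /slow ltey; have := A_first (rshift a i).
  by rewrite /fast /= ltnNge leq_addr/= => ->.
have := @exit_rate_cvg (rshift a i); move: (i_slow) (B_pos i_slow).
rewrite /slow; case: (lim_exit_rate Q (rshift a i)) => //= r _ r0 H.
by exists r => //; move: H => /fine_cvgP[].
Qed.

(** Off the diagonal a rate is dominated by the exit rate, which has a finite limit at a slow state;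
    hence [fine] returns the true limit. *)
Lemma slow_rate_cvg (i : 'I_b) j :
  Q l (rshift a i) j @[l --> +oo] --> fine (lim_rates Q (rshift a i) j).
Proof.
have [r r0 r_cvg] := slow_exit_rate i; rewrite mxE.
have [<-|ij] := eqVneq (rshift a i) j.
  have H : Q l (rshift a i) (rshift a i) @[l --> +oo] --> - r.
    have : - exit_rate (Q l) (rshift a i) @[l --> +oo] --> - r by exact: cvgN.
    by rewrite /exit_rate; under eq_fun do rewrite opprK.
  have /cvg_lim -> // : (Q l (rshift a i) (rshift a i))%:E @[l --> +oo] -->
    (- r)%:E by apply/fine_cvgP; split; [exact: nearW|exact: H].
have cQ := Q_lim ij; set L := lim _ in cQ *.
have L0 : (0 <= L)%E.
  apply: (cvge_ge _ cQ); apply: filterS (@near_gt0 R) => l l0.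
  by rewrite lee_fin offdiag_ge0.
have Lr : (L <= (r + 1)%:E)%E.
  apply: (cvge_le _ cQ); near=> l; rewrite lee_fin.
  have l0 : 0 < l by near: l; exact: near_gt0.
  rewrite (le_trans (rate_le_exit l0 ij))// ltW//.
  by near: l; apply: (cvgr_lt r) => //; rewrite ltrDl.
have Lfin : L \is a fin_num.
  by rewrite ge0_fin_numE// (le_lt_trans Lr)// ltry.
by move: cQ; rewrite -(fineK Lfin) => /fine_cvgP[].
Unshelve. all: by end_near. Qed.

(** Fast exit rates tend to infinity and slow ones to a positive limit, so eventually [jump_mx]
    involves no division by 0. *)
Lemma exit_rate_gt0 :
  \forall l \near +oo, forall i, 0 < exit_rate (Q l) i.
Proof.
apply: filter_forall => i; case: (split_ordP i) => j ->.
  have := fast_exit_rate j 1; apply: filterS => l; exact: lt_le_trans.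
have [r r0 r_cvg] := slow_exit_rate j.
exact: (cvgr_gt r).
Qed.

Lemma jump_cvg i j : jump_mx (Q l) i j @[l --> +oo] --> W i j.
Proof.
rewrite mxE; have [<-|] := eqVneq i j; last exact: W_lim.
have H : jump_mx (Q l) i i @[l --> +oo] --> (0 : R).
  under eq_fun do rewrite mxE eqxx.
  exact: cvg_cst.
by rewrite (cvg_lim _ H).
Qed.

Lemma jump_mul_cvg m (A : 'M[R]_(a + b, m)) i k :
  (jump_mx (Q l) *m A) i k @[l --> +oo] --> (W *m A) i k.
Proof.
under eq_fun do rewrite mxE.
rewrite mxE; apply: cvg_sumr => j.
by apply: cvgM; [exact: jump_cvg|exact: cvg_cst].
Qed.

Lemma slow_mul_cvg m (A : 'M[R]_(a + b, m)) (i : 'I_b) k :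
  (Q l *m A) (rshift a i) k @[l --> +oo] -->
  \sum_j fine (lim_rates Q (rshift a i) j) * A j k.
Proof.
under eq_fun do rewrite mxE.
apply: cvg_sumr => j.
by apply: cvgM; [exact: slow_rate_cvg|exact: cvg_cst].
Qed.

(** Separates the possibly exploding exit rate from a factor that converges by [jump_mul_cvg]. *)
Lemma mul_jump l m (A : 'M[R]_(a + b, m)) i k : 0 < exit_rate (Q l) i ->
  (Q l *m A) i k =
  exit_rate (Q l) i * ((jump_mx (Q l) *m A) i k - A i k).
Proof.
move=> q0; rewrite mulrBr !mxE mulr_sumr (bigD1 i)//= [in RHS](bigD1 i)//=.
rewrite mxE eqxx mul0r mulr0 add0r addrC; congr (_ + _).
  apply: eq_bigr => j ji; rewrite mxE eq_sym (negbTE ji) mulrA; congr (_ * _).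
  by rewrite mulrC divfK// gt_eqF.
by rewrite /exit_rate mulNr opprK.
Qed.

Lemma jump_stochastic : stochastic W.
Proof.
move=> i; split => [j|].
  rewrite mxE -(cvg_lim _ (@jump_cvg i j))//.
  apply: limr_ge; first by apply/cvg_ex; exists (W i j); exact: jump_cvg.
  near=> l.
  have l0 : 0 < l by near: l; exact: near_gt0.
  rewrite mxE; case: eqVneq => // ij.
  by rewrite divr_ge0 ?offdiag_ge0 ?exit_rate_ge0.
have H1 : \sum_j jump_mx (Q l) i j @[l --> +oo] --> \sum_j W i j.
  by apply: cvg_sumr => j; exact: jump_cvg.
have H2 : \sum_j jump_mx (Q l) i j @[l --> +oo] --> (1 : R).
  apply: cvg_near_cst; near=> l.
  have l0 : 0 < l by near: l; exact: near_gt0.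
  have /(_ i) q0 : forall i, 0 < exit_rate (Q l) i.
    by near: l; exact: exit_rate_gt0.
  rewrite (bigD1 i)//= mxE eqxx add0r -[RHS](divff (lt0r_neq0 q0)).
  rewrite {1}exit_rateE// mulr_suml; apply: eq_bigr => j ji.
  by rewrite mxE eq_sym (negbTE ji).
under eq_bigr do rewrite mxE.
by rewrite -(cvg_lim _ H2)// -(cvg_lim _ H1).
Unshelve. all: by end_near. Qed.

End Limits.

(** * The vectors [U] and [g] under the generator for large parameter *)

Section Main.
Variables (R : realType) (a b : nat) (Q : R -> 'M[R]_(a + b)).
Hypotheses (Q_rates : forall l, 0 < l -> rate_matrix (Q l))
  (Q_lim : forall i j, i != j -> cvg ((Q l i j)%:E @[l --> +oo]))
  (A_first : forall i : 'I_(a + b), fast Q i = (i < a)%N)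
  (B_pos : forall i, slow Q i -> (0 < lim_exit_rate Q i)%E)
  (W_lim : forall i j, i != j -> cvg (jump_mx (Q l) i j @[l --> +oo])).
Hypothesis no_trap : forall Z : pred 'I_(a + b),
  (exists i, Z i) -> (forall i, Z i -> ~~ slow Q i) ->
  exists i j, [/\ Z i, ~~ Z j & lim_jump_mx Q i j != 0].

Let W := lim_jump_mx Q.
Let U : 'M[R]_(a + b, b) := col_mx (absorb_mx Q) 1%:M.
Let g : 'cV[R]_(a + b) :=
  col_mx (invmx (1%:M - ulsubmx W) *m const_mx 1) 0.
Let G := reduced_rates Q.

Lemma slowE i : slow Q i = (a <= i)%N.
Proof. by rewrite leqNgt -A_first /slow ltey. Qed.

Lemma jump_min (x : 'cV[R]_(a + b)) :
  (forall i : 'I_b, 0 <= x (rshift a i) 0) ->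
  (forall i : 'I_a, (W *m x) (lshift b i) 0 <= x (lshift b i) 0) ->
  forall i, 0 <= x i 0.
Proof.
move=> xB xA.
have W_st := jump_stochastic Q_rates Q_lim A_first B_pos W_lim.
apply: (min_principle W_st no_trap) => i; rewrite slowE;
  case: (split_ordP i) => j ->.
- by rewrite /= leqNgt ltn_ord.
- by rewrite xB.
- by rewrite xA.
- by rewrite /= leq_addr.
Qed.

Lemma U_sum1 i : \sum_k U i k = 1.
Proof.
apply: (absorb_sum1 jump_min) => j.
have [_ <-] := jump_stochastic Q_rates Q_lim A_first B_pos W_lim j.
by apply: eq_bigr => k _; rewrite [RHS]mxE.
Qed.

Lemma U_ge0 i k : 0 <= U i k.
Proof. exact: (absorb_ge0 jump_min). Qed.

Lemma U_le1 i k : U i k <= 1.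
Proof.
rewrite -(U_sum1 i) (bigD1 k)//= lerDl sumr_ge0// => j _; exact: U_ge0.
Qed.

Lemma reduced_distrE mu : reduced_distr Q mu = mu *m U.
Proof.
by rewrite -[in RHS](hsubmxK mu) mul_row_col mulmx1 addrC.
Qed.

Lemma reduced_is_distr mu : is_distr mu -> is_distr (reduced_distr Q mu).
Proof.
move=> [mu0 mu1]; rewrite reduced_distrE; split => [k|].
  by rewrite mxE sumr_ge0// => i _; rewrite mulr_ge0// U_ge0.
under eq_bigr do rewrite mxE.
rewrite exchange_big/= -[RHS]mu1; apply: eq_bigr => i _.
by rewrite -mulr_sumr U_sum1 mulr1.
Qed.

(** The slow rows of [U] form the identity, so [U *m G] restricts to [G] there, and [G] is by
    definition the slow rows of the limiting rates times [U]. *)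
Lemma reduced_ratesE (i : 'I_b) k :
  (U *m G) (rshift a i) k =
  \sum_j fine (lim_rates Q (rshift a i) j) * U j k.
Proof.
rewrite mul_col_mx col_mxEd mul1mx big_split_ord/= addrC [LHS]mxE.
congr (_ + _); last first.
  rewrite mxE; apply: eq_bigr => j _; rewrite col_mxEu; congr (_ * _).
  by rewrite [LHS]mxE !mxE.
rewrite (bigD1 k)//= big1 => [|j jk]; rewrite col_mxEd [1%:M _ _]mxE.
  by rewrite eqxx addr0 mulr1 [LHS]mxE !mxE.
by rewrite (negbTE jk) mulr0.
Qed.

(** On fast rows [jump_mx (Q l) *m U - U] tends to 0 by harmonicity; multiplying by the exit rate
    leaves an error small relative to that rate. *)
Lemma near_fast_U (e : R) : 0 < e ->
  \forall l \near +oo, forall (i : 'I_a) k,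
    `|(Q l *m U) (lshift b i) k| <= e * exit_rate (Q l) (lshift b i).
Proof.
move=> e0.
have JU : \forall l \near +oo, forall (i : 'I_a) k,
    `|U (lshift b i) k - (jump_mx (Q l) *m U) (lshift b i) k| <= e.
  apply: forall_near => i; apply: forall_near => k.
  have := @jump_mul_cvg _ _ _ _ W_lim _ U (lshift b i) k.
  rewrite (absorb_harmonic jump_min) => H.
  by apply: (cvgrPdist_le _ _).1 e0; exact: H.
apply: filterS2 (exit_rate_gt0 Q_rates Q_lim A_first B_pos) JU => l q0 JUl i k.
by rewrite mul_jump// normrM distrC gtr0_norm// mulrC ler_wpM2r// ltW.
Qed.

Lemma near_slow_U (e : R) : 0 < e ->
  \forall l \near +oo, forall (i : 'I_b) k,
    `|(Q l *m U) (rshift a i) k - (U *m G) (rshift a i) k| <= e.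
Proof.
move=> e0; apply: forall_near => i; apply: forall_near => k.
have H := @slow_mul_cvg _ _ _ _ Q_rates Q_lim A_first B_pos _ U i k.
rewrite reduced_ratesE; under eq_near do rewrite distrC.
by apply: (cvgrPdist_le _ _).1 e0; exact: H.
Qed.

(** The limiting jump matrix lowers [g] by exactly 1 on fast states, so eventually the decrease is
    at least 1/2. *)
Lemma near_fast_g :
  \forall l \near +oo, forall i : 'I_a,
    (Q l *m g) (lshift b i) 0 <= - (exit_rate (Q l) (lshift b i) / 2).
Proof.
have Jg : \forall l \near +oo, forall i : 'I_a,
    (jump_mx (Q l) *m g) (lshift b i) 0 <= g (lshift b i) 0 - 2^-1.
  apply: forall_near => i.
  have := @jump_mul_cvg _ _ _ _ W_lim _ g (lshift b i) 0.
  rewrite (hitting_steps jump_min) => H.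
  by apply: (cvgr_le _ H); rewrite ltrD2l ltrN2 invf_lt1// ltr1n.
apply: filterS2 (exit_rate_gt0 Q_rates Q_lim A_first B_pos) Jg => l q0 Jgl i.
rewrite mul_jump// -mulrN ler_wpM2l//; first exact: ltW.
by rewrite lerBlDl Jgl.
Qed.

Lemma near_slow_bound : exists2 C : R, 0 <= C &
  \forall l \near +oo, forall i : 'I_b,
    (Q l *m g) (rshift a i) 0 <= C /\ exit_rate (Q l) (rshift a i) <= C.
Proof.
pose c (i : 'I_b) := \sum_j fine (lim_rates Q (rshift a i) j) * g j 0.
pose q (i : 'I_b) := - fine (lim_rates Q (rshift a i) (rshift a i)).
(* The summand 1 puts the bound strictly above all the limits [c i] and [q i], so it holds
   eventually. *)
exists (\sum_i `|c i| + \sum_i `|q i| + 1).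
  by rewrite !addr_ge0// sumr_ge0.
have c_le i : c i < \sum_i `|c i| + \sum_i `|q i| + 1.
  rewrite ltr_pwDr// (le_trans (le_sum_norm c i))// lerDl.
  by rewrite sumr_ge0.
have q_le i : q i < \sum_i `|c i| + \sum_i `|q i| + 1.
  rewrite ltr_pwDr// (le_trans (le_sum_norm q i))// lerDr.
  by rewrite sumr_ge0.
apply: forall_near => i; near=> l; split; near: l.
  have H := @slow_mul_cvg _ _ _ _ Q_rates Q_lim A_first B_pos _ g i 0.
  by apply: (cvgr_le _ H); exact: c_le.
have H := @slow_rate_cvg _ _ _ _ Q_rates Q_lim A_first B_pos i (rshift a i).
have {}H : exit_rate (Q l) (rshift a i) @[l --> +oo] --> q i by exact: cvgN.
by apply: (cvgr_le _ H); exact: q_le.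
Unshelve. all: by end_near. Qed.

End Main.

(** * Uniform convergence on time intervals bounded away from 0 *)

Theorem theorem5 (R : realType) (a b : nat) (Q : R -> 'M[R]_(a + b))
  (Q_rates : forall l, 0 < l -> rate_matrix (Q l))
  (Q_irr : forall l, 0 < l -> irreducible_rates (Q l))
  (Q_lim : forall i j, i != j -> cvg ((Q l i j)%:E @[l --> +oo]))
  (A_first : forall i : 'I_(a + b), fast Q i = (i < a)%N)
  (B_neq0 : exists i, slow Q i)
  (B_pos : forall i, slow Q i -> (0 < lim_exit_rate Q i)%E)
  (W_lim : forall i j, i != j -> cvg (jump_mx (Q l) i j @[l --> +oo]))
  (dE : measure_display) (E : measurableType dE)
  (eta : nat -> E -> 'I_(a + b)) (Peta : 'I_(a + b) -> probability E R)
  (eta_dtmc : forall i, is_dtmc (Peta i) eta (delta_mx 0 i) (lim_jump_mx Q))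
  (T_B_fin : forall i, fast Q i ->
     Peta i [set w | (hitting_time R eta (slow Q) w < +oo)%E] = 1%E)
  (mu : 'rV[R]_(a + b)) (mu_distr : is_distr mu) :
  is_distr (reduced_distr Q mu) /\
  forall (dX : measure_display) (EX : measurableType dX)
    (X : R -> EX -> 'I_(a + b)) (PX : R -> probability EX R)
    (X_ctmc : forall l, 0 < l -> is_ctmc (PX l) X mu (Q l))
    (dY : measure_display) (EY : measurableType dY)
    (Y : R -> EY -> 'I_b) (PY : probability EY R)
    (Y_ctmc : is_ctmc PY Y (reduced_distr Q mu) (reduced_rates Q))
    (h T : R) (h_gt0 : 0 < h) (h_lt_T : h < T),
    sup [set dTV (law (PX l) X t) (extend_distr a (law PY Y t)) | t in `[h, T]]
      @[l --> +oo] --> 0.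
Proof.
have no_trap (Z : pred 'I_(a + b)) :
    (exists i, Z i) -> (forall i, Z i -> ~~ slow Q i) ->
    exists i j, [/\ Z i, ~~ Z j & lim_jump_mx Q i j != 0].
  move=> [i Zi] Z_fast; apply: (never_trapped (eta_dtmc i) _ Zi Z_fast).
  apply: T_B_fin; have := Z_fast _ Zi.
  by rewrite A_first (slowE A_first) -ltnNge.
split; first exact: reduced_is_distr.
move=> dX EX X PX X_ctmc dY EY Y PY Y_ctmc h T h_gt0 h_lt_T.
have [pY [pY_tf pY_rates lawY]] := law_flow Y_ctmc.
set W := lim_jump_mx Q.
pose U : 'M[R]_(a + b, b) := col_mx (absorb_mx Q) 1%:M.
pose g : 'cV[R]_(a + b) :=
  col_mx (invmx (1%:M - ulsubmx W) *m const_mx 1) 0.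
pose G := reduced_rates Q.
have W_min := jump_min Q_rates Q_lim A_first B_pos W_lim no_trap.
pose K := \sum_i \sum_k `|(U *m G) i k|.
pose L := \sum_i `|g i 0|.
have [C C_ge0 C_near] :=
  near_slow_bound Q_rates Q_lim A_first B_pos.
have K_ge0 : 0 <= K by apply: sumr_ge0 => i _; exact: sumr_ge0.
have L_ge0 : 0 <= L by exact: sumr_ge0.
have UG_le i k : `|(U *m G) i k| <= K.
  rewrite /K (bigD1 i)//= (bigD1 k)//= -addrA lerDl addr_ge0 ?sumr_ge0//.
  by move=> j _; exact: sumr_ge0.
(* The constant of [dTV_le]. It does not depend on [l] and grows with [t], so [D T] serves the whole
   interval. *)
pose D t := (1 + b%:R) * (3 * C + 2 * L) +
   b%:R * (b%:R * (t + 2 * (1 + K) * (C * t + L))).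
have T_gt0 : 0 < T by exact: lt_trans h_lt_T.
have D_ge0 t : 0 <= t -> 0 <= D t.
  by move=> t0; rewrite /D ?(addr_ge0, mulr_ge0).
have D_mono t : 0 <= t <= T -> D t <= D T.
  move=> /andP[t0 tT]; rewrite /D lerD2l !ler_wpM2l// lerD// ler_wpM2l//.
    by rewrite mulr_ge0// addr_ge0.
  by rewrite lerD2r ler_wpM2l.
apply/cvgrPdist_le => e e_gt0.
(* [dTV_le] requires [eps <= 1] and [eps <= t], the latter for every [t >= h]. The last bound gives
   [D T * eps <= e], and its summand 1 keeps the denominator positive. *)
pose eps := Num.min (Num.min 1 h) (e / (D T + 1)).
have DT_gt0 : 0 < D T + 1 by rewrite ltr_wpDl// D_ge0// ltW.
have eps_gt0 : 0 < eps by rewrite !lt_min ltr01 h_gt0 divr_gt0.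
have eps_le1 : eps <= 1 by rewrite !ge_min lexx.
have eps_leh : eps <= h by rewrite !ge_min lexx orbT.
have eps_e : D T * eps <= e.
  have : eps <= e / (D T + 1) by rewrite !ge_min lexx !orbT.
  rewrite ler_pdivlMr// mulrC; apply: le_trans.
  by rewrite ler_wpM2r ?lerDl// ltW.
have fast_near : \forall l \near +oo, forall i : 'I_a,
    1 <= eps ^+ 2 * exit_rate (Q l) (lshift b i).
  apply: forall_near => i.
  apply: filterS (fast_exit_rate Q_rates Q_lim A_first i (eps ^+ 2)^-1) => l.
  by rewrite -ler_pdivrMl ?exprn_gt0// mulr1.
have fastU_near :=
  near_fast_U Q_rates Q_lim A_first B_pos W_lim no_trap eps_gt0.
have slowU_near := near_slow_U Q_rates Q_lim A_first B_pos eps_gt0.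
have fastg_near := near_fast_g Q_rates Q_lim A_first B_pos W_lim no_trap.
near=> l.
have l_gt0 : 0 < l by near: l; exact: near_gt0.
have fastU : forall (i : 'I_a) k,
    `|(Q l *m U) (lshift b i) k| <= eps * exit_rate (Q l) (lshift b i).
  by near: l.
have slowU : forall (i : 'I_b) k,
    `|(Q l *m U) (rshift a i) k - (U *m G) (rshift a i) k| <= eps by near: l.
have fastg : forall i : 'I_a,
    (Q l *m g) (lshift b i) 0 <= - (exit_rate (Q l) (lshift b i) / 2).
  by near: l.
have slowC : forall i : 'I_b,
    (Q l *m g) (rshift a i) 0 <= C /\ exit_rate (Q l) (rshift a i) <= C.
  by near: l.
have fastq : forall i : 'I_a, 1 <= eps ^+ 2 * exit_rate (Q l) (lshift b i).
  by near: l.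
have [p [p_tf p_rates lawX]] := law_flow (X_ctmc _ l_gt0).
have dist_le t : h <= t <= T ->
    dTV (law (PX l) X t) (extend_distr a (law PY Y t)) <= e.
  move=> /andP[ht tT]; have t0 : 0 <= t by rewrite (le_trans _ ht)// ltW.
  rewrite lawX// lawY// reduced_distrE.
  apply: (@le_trans _ _ (D t * eps)); last first.
    apply: le_trans eps_e; apply: ler_wpM2r; first exact: ltW.
    by apply: D_mono; rewrite t0.
  apply: (dTV_le (Q := Q l) (G := G) (g := g)) => //.
  - exact: Q_rates.
  - by move=> i k; rewrite /U col_mxEd mxE.
  - exact: (absorb_ge0 W_min).
  - exact: (U_le1 Q_rates Q_lim A_first B_pos W_lim no_trap).
  - exact: (hitting_steps_ge0 W_min).
  - by move=> i; exact: (le_sum_norm (fun i => g i 0)).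
  - by move=> i; case: (slowC i).
  - by move=> i; case: (slowC i).
  - exact: le_trans ht.
have dTV_ge0 t : 0 <= dTV (law (PX l) X t) (extend_distr a (law PY Y t)).
  by rewrite /dTV mulr_ge0 ?invr_ge0 ?sumr_ge0.
set S := [set _ | _ in _].
(* The supremum needs a nonempty set to be at most [e], and a nonnegative member to be nonnegative;
   time [h] supplies both. *)
have Sh : S (dTV (law (PX l) X h) (extend_distr a (law PY Y h))).
  by exists h => //=; rewrite in_itv/= lexx ltW.
have S_ub : ubound S e.
  by move=> x [t + <-]; rewrite /= in_itv/=; exact: dist_le.
rewrite sub0r normrN ger0_norm.
  by apply: ge_sup => //; eexists; exact: Sh.
by apply: le_trans (dTV_ge0 h) _; apply: ub_le_sup => //; exists e.
Unshelve. all: by end_near. Qed.
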